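(* Let $\epsilon>0$. Then the set $$\left\{m\in D^+ \;\middle|\; \text{for all integers } k \text{ with } 0\leq k\leq\left(\log_2\tfrac{4}{3}\right)^{-1}\log_2 m:\ \left(\tfrac{3}{4}\right)^{k}m^{1-\epsilon}\leq \mathsf{Syr}^k(m)\leq \left(\tfrac{3}{4}\right)^k m^{1+\epsilon}\right\}$$ is of natural density $1$ in $D^+$.
   Context: $D^+$ is the set of odd positive integers. For a positive integer $n$, $\nu_2(n)$ is the maximal natural number $k$ such that $2^k$ divides $n$. The Syracuse map $\mathsf{Syr}:D^+\to D^+$ is defined by $\mathsf{Syr}(m)=\frac{3m+1}{2^{\nu_2(3m+1)}}$; $\mathsf{Syr}^k$ denotes its $k$-fold iterate ($\mathsf{Syr}^0$ is the identity). A set $A\subseteq D^+$ is of natural density $1$ in $D^+$ if $\liminf_{n\to\infty}\frac{\#\{m\in A\mid m\leq 2n+1\}}{n+1}=1$. *)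

(* Defs.v *)
From mathcomp Require Import all_boot all_order all_algebra.
From mathcomp Require Import all_classical all_reals all_analysis.

Set Implicit Arguments.
Unset Strict Implicit.
Unset Printing Implicit Defensive.

Import Order.TTheory GRing.Theory Num.Theory.

Local Open Scope classical_set_scope.
Local Open Scope ring_scope.

Definition Dplus : set nat := [set m : nat | odd m].

(* [Syr] is defined on all of [nat]; it is only meaningful on [Dplus], which it
   preserves by [Syr_Dplus]. The division is exact. *)
Definition Syr (m : nat) : nat :=
  ((3 * m + 1) %/ 2 ^ logn 2 (3 * m + 1))%N.

Lemma Syr_Dplus (m : nat) : Dplus m -> Dplus (Syr m).
Proof.
move=> _; rewrite /Dplus/= /Syr addn1.
have [n n_odd e] := pfactor_coprime (isT : prime 2) (ltn0Sn (3 * m)).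
by rewrite [X in (X %/ _)%N]e mulnK ?expn_gt0// -coprime2n.
Qed.

Definition logb (R : realType) (b x : R) : R := ln x / ln b.

Definition count_upto (A : set nat) (N : nat) : nat :=
  #|[pred m : 'I_N.+1 | (m : nat) \in A]|.

(* For A in [Dplus] the sequence has values in [0, 1], so the real-valued
   [limn_inf] is the true limit inferior. *)
Definition natural_density_one_in_Dplus (R : realType) (A : set nat) : Prop :=
  A `<=` Dplus /\
  limn_inf (fun n : nat => (count_upto A (2 * n + 1)%N)%:R / n.+1%:R : R) = 1.

(* Main.v *)
Require Import Defs.
From mathcomp Require Import all_boot all_order all_algebra.
From mathcomp Require Import all_classical all_reals all_analysis.
From mathcomp Require Import zify ring lra.

Import Order.TTheory GRing.Theory Num.Theory.
Import numFieldNormedType.Exports.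

Local Open Scope classical_set_scope.

(** The proof runs through the Terras map T, T(m) = m/2 or (3m+1)/2, of which
    Syr is an acceleration: Syr^k(m) = T^s(m), where the first s steps from m
    contain exactly k odd ones. Write o_j(m) for the number of odd values among
    m, T(m), ..., T^(j-1)(m), so that T^j(m) is about 3^(o_j(m)) 2^(-j) m, and
    write q(m) for the integer part of log_2 m. The size of an iterate is
    governed by the drift 2 o_j(m) - j, and everything reduces to showing that,
    for each kappa < 2 / log_2(4/3) and e > 0, almost no m has a j <= kappa q(m)
    with |2 o_j(m) - j| > e q(m).

    Almost no m is understood in a strong sense: a set is sparse if it has at
    most C 2^((1-c)q) elements in the block [2^q, 2^(q+1)), for some c > 0 and
    all q. Power-saving bounds are what makes an induction possible, since they
    survive losses of a factor 2^(delta q) with small delta.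

    For j <= q(m) the claim is classical. On a block of length 2^q the first q
    parities run once through all binary words ([block_parities_inj]), so that
    the exceptional m are counted by a Chernoff bound
    ([unbalanced_words_sparse]). This uses up the binary digits of m. To go on,
    one restarts from y = T^q(m), and has to know that m seldom lands in the
    sparse set of those y which drift themselves. Now y has size about 3^(q/2),
    and a typical y is reached from about 2^q / 3^(q/2) of the m. The heart of
    the proof is that no y is reached from many more balanced m than that
    ([count_fiber]). Indeed 2^q y = 3^o m + F with o = o_q(m), where F depends
    on the parities only. Cut the parity word after q - r letters. The first
    part, together with y and the number of odd steps in each part, determines
    modulo 3^o the offset of the last r letters. For a balanced word this offset
    is at most about 2^r, so if r is slightly below (q/2) log_2 3 it is smaller
    than 3^o, hence determined, and then so is m ([fiber_inj]). This leaves at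
    most (r+1) 2^(q-r) values of m, which is 2^q / 3^(q/2) up to a factor
    2^(delta q).

    Hence the preimage of a sparse set under m |-> T^(q(m))(m) is sparse
    ([sparse_pullback]), and control up to kappa q(m) improves to control up to
    (1 + kappa mu) q(m) for every mu < (log_2 3)/2 ([drifting_step]). Iterating
    from 0, the constants 1 + mu + ... + mu^n approach 1/(1 - mu), whose
    supremum over mu is 2 / log_2(4/3) ([drifting_sparse]).

    Small drift gives the two bounds for Syr^k(m) when s <= kappa q(m). For the
    remaining k one has k >= (1 - O(e)) log m / log(4/3): there the lower bound
    is below 1, and the iterates gain at most a factor 2 per remaining Syracuse
    step, of which there are O(e log m) ([Syr_bounds_of_drift]). *)

(** * The Terras map and parity words *)

Local Open Scope nat_scope.

Definition terras (m : nat) : nat := if odd m then (3 * m + 1)./2 else m./2.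

Fixpoint parities (j m : nat) : seq bool :=
  if j is j'.+1 then odd m :: parities j' (terras m) else [::].

Definition odds (j m : nat) : nat := count id (parities j m).

(** The term F in 2^j T^j(m) = 3^o m + F, for a trajectory with parity word w. *)
Fixpoint offset (w : seq bool) : nat :=
  if w is b :: w' then b * 3 ^ count id w' + 2 * offset w' else 0.

Lemma size_parities j m : size (parities j m) = j.
Proof. by elim: j m => //= j IH m; rewrite IH. Qed.

Lemma parities_cat i j m :
  parities (i + j) m = parities i m ++ parities j (iter i terras m).
Proof.
elim: i m => //= i IH m.
by rewrite IH -iterS iterSr.
Qed.

Lemma oddsD i j m : odds (i + j) m = odds i m + odds j (iter i terras m).
Proof. by rewrite /odds parities_cat count_cat. Qed.

Lemma odds_le {i j} m : i <= j -> odds i m <= odds j m.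
Proof. by move=> /subnKC <-; rewrite oddsD leq_addr. Qed.

Lemma odds_leq j m : odds j m <= j.
Proof. by rewrite -{2}(size_parities j m) /odds count_size. Qed.

Lemma double_terras m : 2 * terras m = 3 ^ odd m * m + odd m.
Proof.
rewrite /terras; case: ifP => om; rewrite ?om /=; have := odd_double_half m; rewrite om.
  have := odd_double_half (3 * m + 1); rewrite oddD oddM om /=; lia.
by rewrite expn0; lia.
Qed.

Lemma offset_cat u v :
  offset (u ++ v) = 3 ^ count id v * offset u + 2 ^ size u * offset v.
Proof.
elim: u => [|b u IH] /=; first by rewrite muln0 expn0; lia.
rewrite IH count_cat expnD expnS; ring.
Qed.

Lemma iter_terrasE j m :
  2 ^ j * iter j terras m = 3 ^ odds j m * m + offset (parities j m).
Proof.
elim: j m => [|j IH] m; first by rewrite /odds /= !expn0; lia.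
rewrite iterSr expnS -mulnA IH /odds /= mulnDr mulnCA double_terras expnD; ring.
Qed.

Lemma eq_modM_coprime {a d x y} :
  coprime d a -> a * x = a * y %[mod d] -> x = y %[mod d].
Proof.
move=> co; wlog le : x y / y <= x => [H|].
  by case/orP: (leq_total y x) => h /esym e; [|symmetry]; apply: H.
move=> /eqP; rewrite eqn_mod_dvd ?leq_mul2l ?le ?orbT // -mulnBr Gauss_dvdr //.
by rewrite -eqn_mod_dvd // => /eqP.
Qed.

Lemma parities_inj {j m m'} :
  parities j m = parities j m' -> m = m' %[mod 2 ^ j].
Proof.
move=> e; apply: (@eq_modM_coprime (3 ^ odds j m)).
  by rewrite coprimeXl // coprimeXr.
apply/eqP; rewrite -(eqn_modDr (offset (parities j m))) -iter_terrasE.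
rewrite /odds e -/(odds j m') -iter_terrasE.
by rewrite !modnMr.
Qed.

Lemma iter_terras_gt0 j m : 0 < m -> 0 < iter j terras m.
Proof.
move=> m0; have := iter_terrasE j m.
have : 0 < 3 ^ odds j m * m by rewrite muln_gt0 expn_gt0.
case: (iter j terras m) => //; rewrite muln0; lia.
Qed.

(** An odd step at most doubles, because (3x+1)/2 <= 2x for x >= 1, and an even
    step halves. *)
Lemma iter_terras_leq j m : iter j terras m <= 2 ^ odds j m * m.
Proof.
elim: j m => [|j IH] m; first by rewrite /odds /= expn0; lia.
rewrite iterSr; apply: leq_trans (IH _) _.
rewrite /odds /= expnD mulnAC [leqRHS]mulnC leq_pmul2l ?expn_gt0 //.
have := double_terras m; case om : (odd m) => /=; case: m om => //= m om; rewrite ?expn0; lia.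
Qed.

Definition balanced (D : nat) (w : seq bool) : bool :=
  all (fun j => (2 * count id (take j w) <= j + D) &&
                (j <= 2 * count id (take j w) + D)) (iota 0 (size w).+1).

Lemma take_parities {i j} m : i <= j -> take i (parities j m) = parities i m.
Proof.
by move=> /subnKC <-; rewrite parities_cat take_size_cat ?size_parities.
Qed.

Lemma balancedP D j m :
  reflect (forall i, i <= j -> 2 * odds i m <= i + D /\ i <= 2 * odds i m + D)
          (balanced D (parities j m)).
Proof.
rewrite /balanced size_parities; apply: (iffP allP) => H i.
  move=> le; have := H i; rewrite mem_iota /= take_parities //.
  by rewrite add0n ltnS => /(_ le) /andP[].
rewrite mem_iota /= add0n ltnS => le; rewrite take_parities //.
by have [-> ->] := H i le.
Qed.

(** The i-th letter contributes at most 2^i 3^(count of the later letters).  If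
    about half of the later letters are odd, this is 2^i times a power of
    sqrt 3 < 2, up to 3^D, so that each letter contributes at most 2^(size v) 3^D. *)
Lemma offset_leq D v :
  (forall i, 2 * count id (drop i v) <= size v - i + 2 * D) ->
  offset v <= size v * 2 ^ size v * 3 ^ D.
Proof.
elim: v => //= b v IH H.
have {}IH : offset v <= size v * 2 ^ size v * 3 ^ D by apply: IH => i; exact: H i.+1.
have {}H : 2 * count id v <= size v + 2 * D by have := H 1; rewrite drop1 subn1.
have H3 : 3 ^ count id v <= 2 ^ size v * 3 ^ D.
  rewrite -(@leq_exp2r _ _ 2) //.
  have -> : (2 ^ size v * 3 ^ D) ^ 2 = 4 ^ size v * 3 ^ (2 * D).
    by rewrite expnMn -!expnM mulnC (mulnC D) (mulnC _ 2) [2 ^ (2 * _)]expnM mulnC.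
  rewrite -expnM (mulnC _ 2); apply: (@leq_trans (3 ^ (size v + 2 * D))).
    by rewrite leq_exp2l.
  rewrite expnD leq_mul2r; apply/orP; right.
  by case: (size v) => [|n]; rewrite ?expn0 // leq_exp2r.
apply: (@leq_trans (1 * (2 ^ size v * 3 ^ D) + 2 * (size v * 2 ^ size v * 3 ^ D))).
  by apply: leq_add; [apply: leq_mul => //; case: b|rewrite leq_mul2l IH orbT].
rewrite expnS; nia.
Qed.

Lemma balanced_offset_suffix {D j r m} : r <= j -> balanced D (parities j m) ->
  offset (parities r (iter (j - r) terras m)) <= r * 2 ^ r * 3 ^ D.
Proof.
move=> le /balancedP H.
have := @offset_leq D (parities r (iter (j - r) terras m)).
rewrite !size_parities; apply => i.
have [lei|/ltnW lei] := leqP r i; first by rewrite drop_oversize ?size_parities.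
have [_ H1] := H (j - r + i) ltac:(lia).
have [H2 _] := H j (leqnn j).
have Ej : j - r + i + (r - i) = j by lia.
have := oddsD (j - r + i) (r - i) m.
rewrite Ej [_ + i]addnC iterD.
rewrite -[X in drop i (parities X _)](subnKC lei) parities_cat.
rewrite drop_size_cat ?size_parities // -/(odds _ _) => E.
rewrite -[i + (j - r)]addnC in E.
lia.
Qed.

(** The common end point gives 3^o m + 2^(j-r) F = 3^o m' + 2^(j-r) F', where F
    and F' are the offsets of the last r letters.  So F = F' modulo 3^o, and
    the numerical hypothesis puts both below 3^o, because 2 o >= j - D. *)
Lemma fiber_inj {D j r m m'} : r <= j ->
  (r * 2 ^ r) ^ 2 * 27 ^ D < 3 ^ j ->
  balanced D (parities j m) -> balanced D (parities j m') ->
  iter j terras m = iter j terras m' ->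
  parities (j - r) m = parities (j - r) m' ->
  odds r (iter (j - r) terras m) = odds r (iter (j - r) terras m') ->
  m = m'.
Proof.
move=> le lt gm gm' eT eP eO.
have eodds n : odds j n = odds (j - r) n + odds r (iter (j - r) terras n).
  by rewrite -oddsD subnK.
have eo : odds j m = odds j m' by rewrite !eodds eO /odds eP.
have expand n : 2 ^ j * iter j terras n =
    3 ^ odds j n * n + (3 ^ odds r (iter (j - r) terras n) * offset (parities (j - r) n)
     + 2 ^ (j - r) * offset (parities r (iter (j - r) terras n))).
  by rewrite iter_terrasE; congr (_ + _); rewrite -{1}(subnK le) parities_cat offset_cat size_parities.
have small n : balanced D (parities j n) ->
    offset (parities r (iter (j - r) terras n)) < 3 ^ odds j n.
  move=> gn; have := balanced_offset_suffix le gn.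
  have /balancedP/(_ j (leqnn j))[_ lo] := gn.
  move=> /leq_ltn_trans; apply.
  rewrite -(@ltn_exp2r _ _ 2) // expnMn -(@ltn_pmul2r (3 ^ D)) ?expn_gt0 //.
  have -> : (r * 2 ^ r) ^ 2 * (3 ^ D) ^ 2 * 3 ^ D = (r * 2 ^ r) ^ 2 * 27 ^ D.
    by rewrite -mulnA -expnSr -expnM mulnC [X in 3 ^ X]mulnC (expnM 3 3) mulnC.
  by rewrite (leq_trans lt) // -expnM -expnD leq_exp2l // mulnC.
have := expand m; rewrite eT expand -eP -eO -eo.
set F := offset (parities r _); set F' := offset (parities r _) => E.
have {E} E : 3 ^ odds j m * m + 2 ^ (j - r) * F' = 3 ^ odds j m * m' + 2 ^ (j - r) * F.
  by move: E; rewrite -/F; lia.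
have := small _ gm; have := small _ gm'; rewrite -eo -/F -/F' => ltF' ltF.
suff eF : F = F' by move: E; rewrite eF => /addIn/eqP; rewrite eqn_pmul2l ?expn_gt0 // => /eqP.
rewrite -(modn_small ltF) -(modn_small ltF').
apply: (@eq_modM_coprime (2 ^ (j - r))); first by rewrite coprimeXl // coprimeXr.
by rewrite -(modnMDl m') mulnC -E mulnC modnMDl.
Qed.

(** * Counting in dyadic blocks *)

Fixpoint words (j : nat) : seq (seq bool) :=
  if j is j'.+1 then map (cons true) (words j') ++ map (cons false) (words j')
  else [:: [::]].

Lemma size_words j : size (words j) = 2 ^ j.
Proof. by elim: j => //= j IH; rewrite size_cat !size_map IH expnS mul2n addnn. Qed.

Lemma parities_words j m : parities j m \in words j.
Proof.
elim: j m => [//|j IH] m /=; rewrite mem_cat; apply/orP.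
by case: (odd m); [left|right]; apply: map_f.
Qed.

Lemma size_mem_words {j w} : w \in words j -> size w = j.
Proof.
elim: j w => [|j IH] w /=; first by rewrite inE => /eqP ->.
by rewrite mem_cat => /orP[] /mapP[v /IH <- ->].
Qed.

Definition block (q : nat) : seq nat := index_iota (2 ^ q) (2 ^ q.+1).

Lemma mem_block q m : (m \in block q) = (2 ^ q <= m < 2 ^ q.+1).
Proof. exact: mem_index_iota. Qed.

Lemma block_gt0 {q m} : m \in block q -> 0 < m.
Proof. by rewrite mem_block => /andP[+ _]; apply: leq_trans; rewrite expn_gt0. Qed.

Lemma count_blocks (S : pred nat) Q :
  count S (index_iota 1 (2 ^ Q)) = \sum_(q < Q) count S (block q).
Proof.
elim: Q => [|Q IH]; first by rewrite big_ord0.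
rewrite big_ord_recr /= -IH -count_cat /block /index_iota.
have h : 2 ^ Q.+1 - 1 = (2 ^ Q - 1) + (2 ^ Q.+1 - 2 ^ Q).
  by rewrite expnS; have : 0 < 2 ^ Q; [rewrite expn_gt0|lia].
by rewrite h iotaD subnKC // expn_gt0.
Qed.

(** The block is a full system of residues modulo 2^q, and the parity word
    determines the residue. *)
Lemma block_parities_inj {q} : {in block q &, injective (parities q)}.
Proof.
have low m : m \in block q -> m - 2 ^ q < 2 ^ q /\ m = m - 2 ^ q + 2 ^ q.
  by rewrite mem_block expnS; lia.
move=> m m' /low[l e] /low[l' e'] /parities_inj.
by rewrite e e' !modnDr !modn_small // => ->.
Qed.

(** Statistics of parities over a block are dominated by those over all words,
    since distinct elements have distinct words. *)
Lemma count_block_words (P : pred (seq bool)) q :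
  count (fun m => P (parities q m)) (block q) <= count P (words q).
Proof.
rewrite -!size_filter -(size_map (parities q)).
apply: uniq_leq_size.
  rewrite map_inj_in_uniq ?filter_uniq ?iota_uniq // => m m'.
  by rewrite !mem_filter => /andP[_ +] /andP[_]; exact: block_parities_inj.
move=> _ /mapP[m + ->]; rewrite !mem_filter => /andP[-> _].
exact: parities_words.
Qed.

(** [fiber_inj] encodes the elements of the fibre by a word of length q - r and a
    number at most r. *)
Lemma count_fiber {D q r y} (s : seq nat) : uniq s -> r <= q ->
  (r * 2 ^ r) ^ 2 * 27 ^ D < 3 ^ q ->
  count (fun m => balanced D (parities q m) && (iter q terras m == y)) s
    <= 2 ^ (q - r) * r.+1.
Proof.
move=> us le lt; rewrite -size_filter.
pose code m := (parities (q - r) m, odds r (iter (q - r) terras m)).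
rewrite -(size_map code) -(size_words (q - r)) -[X in _ * X](size_iota 0).
rewrite -(size_allpairs pair).
apply: uniq_leq_size.
  rewrite map_inj_in_uniq ?filter_uniq // => m m'.
  rewrite !mem_filter => /andP[/andP[gm /eqP em] _] /andP[/andP[gm' /eqP em'] _].
  by move=> [eP eO]; apply: (fiber_inj le lt gm gm') => //; rewrite em em'.
move=> _ /mapP[m _ ->]; apply/allpairsP; exists (code m); split => //.
  exact: parities_words.
by rewrite mem_iota /= add0n ltnS odds_leq.
Qed.

(** For f = T^q the fibres are bounded by [count_fiber], and ys is an interval that
    contains the relevant values of f. *)
Lemma count_comp_leq {K} {P S : pred nat} {f : nat -> nat} (s ys : seq nat) :
  (forall y, count (fun m => P m && (f m == y)) s <= K) ->
  count (fun m => [&& P m, S (f m) & f m \in ys]) s <= K * count S ys.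
Proof.
move=> H; elim: ys => [|y ys IH] /=.
  by rewrite muln0 (@eq_count _ _ pred0) ?count_pred0 // => m /=; rewrite in_nil !andbF.
rewrite mulnDr; apply: (@leq_trans (count (fun m => [&& P m, S y & f m == y]) s +
   count (fun m => [&& P m, S (f m) & f m \in ys]) s)).
  rewrite -count_predUI; apply: leq_trans (leq_addr _ _).
  apply: sub_count => m /= /and3P[-> Sf]; rewrite inE Sf => /orP[/eqP e|->].
    by rewrite -e Sf eqxx.
  by rewrite orbT.
apply: leq_add => //; case: (S y); rewrite ?muln1 ?muln0 /=.
  by apply: leq_trans (H y).
by rewrite (@eq_count _ _ pred0) ?count_pred0 // => m /=; rewrite andbF.
Qed.

Lemma balanced_iter_leq {D q m} : m < 2 ^ q.+1 -> balanced D (parities q m) ->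
  iter q terras m ^ 2 <= q.+2 ^ 2 * 3 ^ (q + 3 * D).
Proof.
move=> lm gm; have := balanced_offset_suffix (leqnn q) gm; rewrite subnn /= => off.
have /balancedP/(_ q (leqnn q))[hi _] := gm.
have {}hi : 3 ^ (2 * (odds q m + D)) <= 3 ^ (q + 3 * D) by rewrite leq_exp2l //; lia.
apply: leq_trans (_ : q.+2 ^ 2 * 3 ^ (2 * (odds q m + D)) <= _); last first.
  by rewrite leq_mul2l hi orbT.
rewrite (mulnC 2) expnM -expnMn leq_exp2r //.
rewrite -(@leq_pmul2l (2 ^ q)) ?expn_gt0 // iter_terrasE.
have h3 : 3 ^ odds q m * m <= 3 ^ (odds q m + D) * 2 ^ q.+1.
  by rewrite leq_mul ?(ltnW lm) // leq_exp2l // leq_addr.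
have h4 : offset (parities q m) <= q * 2 ^ q * 3 ^ (odds q m + D).
  by apply: leq_trans off _; rewrite leq_mul2l leq_exp2l // leq_addl orbT.
apply: leq_trans (leq_add h3 h4) _; rewrite expnS; nia.
Qed.

(** Those m whose word is unbalanced are counted as they are; the others land in
    [1, 2^Q), by [balanced_iter_leq], and their fibres are bounded by
    [count_fiber]. *)
Lemma count_pullback {D q r Q} (S : pred nat) : r <= q ->
  (r * 2 ^ r) ^ 2 * 27 ^ D < 3 ^ q ->
  q.+2 ^ 2 * 3 ^ (q + 3 * D) < 4 ^ Q ->
  count (fun m => S (iter q terras m)) (block q) <=
    count (fun m => ~~ balanced D (parities q m)) (block q) +
    2 ^ (q - r) * r.+1 * \sum_(i < Q) count S (block i).
Proof.
move=> le lt ltQ; rewrite -count_blocks.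
have := @count_comp_leq _ _ S _ (block q) (index_iota 1 (2 ^ Q))
  (fun y => @count_fiber D q r y _ (iota_uniq _ _) le lt).
rewrite -(leq_add2l (count (fun m => ~~ balanced D (parities q m)) (block q))).
apply: leq_trans; rewrite -count_predUI; apply: leq_trans (leq_addr _ _).
rewrite (@eq_in_count _ _ (fun m => (m \in block q) && S (iter q terras m))); last first.
  by move=> m /= ->.
apply: sub_count => m /= /andP[mb ->].
case gm : (balanced D (parities q m)) => //=.
rewrite mem_index_iota iter_terras_gt0 ?(block_gt0 mb) //=.
have lm : m < 2 ^ q.+1 by move: mb; rewrite mem_block => /andP[].
rewrite -(@ltn_exp2r _ _ 2) // (leq_ltn_trans (balanced_iter_leq lm gm)) //.
by rewrite (leq_trans ltQ) // -expnM mulnC expnM.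
Qed.

Local Open Scope ring_scope.

(** * Large deviations for parity words *)

(** Each of the first j letters contributes a factor mu or 1/mu, so that these
    factors add up to mu + 1/mu, while each other letter contributes a factor
    2 <= mu + 1/mu. *)
Lemma sum_words_tilt {R : realType} (mu : R) q j : 0 < mu -> (j <= q)%N ->
  \sum_(w <- words q) mu ^+ (2 * count id (take j w)) / mu ^+ j
    <= (mu + mu^-1) ^+ q.
Proof.
move=> mu0.
have ge2 : 2 <= mu + mu^-1.
  rewrite -subr_ge0 (_ : _ - _ = (mu - 1) ^+ 2 / mu); last by field; rewrite gt_eqF.
  by rewrite divr_ge0 ?sqr_ge0 // ltW.
elim: q j => [|q IH] j le.
  by move: le; rewrite leqn0 => /eqP ->; rewrite big_seq1 muln0 !expr0 divr1.
have step (F : seq bool -> R) :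
    \sum_(w <- words q.+1) F w = \sum_(w <- words q) (F (true :: w) + F (false :: w)).
  by rewrite /= big_cat /= !big_map big_split.
have mun0 : mu != 0 by rewrite gt_eqF.
rewrite step exprS; case: j le => [_|j le].
  rewrite big_split /=; have := IH 0%N (leq0n _).
  rewrite [X in X <= _](eq_bigr (fun=> mu ^+ 0 / mu ^+ 0)); last by move=> w _; rewrite take0.
  set s := \sum_(_ <- _) _ => H.
  have s0 : 0 <= (mu + mu^-1) ^+ q by rewrite exprn_ge0 // (le_trans _ ge2).
  by rewrite (_ : s + s = 2 * s); [nra|ring].
apply: le_trans (_ : (mu + mu^-1) * \sum_(w <- words q) mu ^+ (2 * count id (take j w)) / mu ^+ j <= _).
  rewrite mulr_sumr; apply: ler_sum => w _ /=.
  set c := count id _.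
  have -> : (2 * (true + c) = 2 + 2 * c)%N by rewrite mulnDr.
  have -> : (2 * (false + c) = 2 * c)%N by [].
  rewrite exprD expr2 exprS le_eqVlt; apply/orP; left; apply/eqP.
  by field; rewrite mun0 expf_neq0.
rewrite ler_wpM2l ?IH //; exact: le_trans ge2.
Qed.

(** The prefix that violates the balance makes one of the two terms large: the
    one with lam if it has too many odd letters, the one with 1/lam if it has too
    few. *)
Lemma unbalanced_word_tilt {R : realType} (lam : R) D w : 1 <= lam -> ~~ balanced D w ->
  lam ^+ D.+1 <= \sum_(j < (size w).+1)
     (lam ^+ (2 * count id (take j w)) / lam ^+ j
      + lam^-1 ^+ (2 * count id (take j w)) / lam^-1 ^+ j).
Proof.
move=> l1 /allPn[j]; rewrite mem_iota /= add0n => lj bad.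
have l0 : 0 < lam by apply: lt_le_trans l1.
rewrite (bigD1 (Ordinal lj)) //= -[X in X <= _]addr0 lerD //; last first.
  by apply: sumr_ge0 => i _; rewrite addr_ge0 // divr_ge0 // exprn_ge0 // ?invr_ge0 ltW.
set c := (2 * _)%N in bad *.
rewrite exprVn [X in _ + _ / X]exprVn invrK.
move: bad; rewrite negb_and -!ltnNge => /orP[] h.
  rewrite -[X in X <= _]addr0 lerD //; last by rewrite mulr_ge0 ?invr_ge0 ?exprn_ge0 // ltW.
  by rewrite ler_pdivlMr ?exprn_gt0 // -exprD ler_weXn2l //; lia.
rewrite -[X in X <= _]add0r lerD //; first by rewrite divr_ge0 // exprn_ge0 // ltW.
by rewrite mulrC ler_pdivlMr ?exprn_gt0 // -exprD ler_weXn2l //; lia.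
Qed.

Lemma count_unbalanced_words {R : realType} (lam : R) D q : 1 <= lam ->
  (count (predC (balanced D)) (words q))%:R * lam ^+ D.+1
    <= q.+1%:R * (2 * (lam + lam^-1) ^+ q).
Proof.
move=> l1; have l0 : 0 < lam by apply: lt_le_trans l1.
apply: le_trans (_ : \sum_(w <- words q) \sum_(j < q.+1)
     (lam ^+ (2 * count id (take j w)) / lam ^+ j
      + lam^-1 ^+ (2 * count id (take j w)) / lam^-1 ^+ j) <= _).
  rewrite -sum1_count natr_sum mulr_suml big_mkcond /= big_seq [leRHS]big_seq.
  apply: ler_sum => w /size_mem_words sw; case: ifP => gw.
    by rewrite mul1r -[in leRHS]sw unbalanced_word_tilt.
  by apply: sumr_ge0 => i _; rewrite addr_ge0 // divr_ge0 // exprn_ge0 // ?invr_ge0 ltW.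
rewrite exchange_big /= (_ : q.+1%:R * _ = \sum_(j < q.+1) 2 * (lam + lam^-1) ^+ q); last first.
  by rewrite sumr_const card_ord mulr_natl.
apply: ler_sum => j _; rewrite big_split /= mulrDl mul1r lerD //.
  by rewrite sum_words_tilt // -ltnS.
by rewrite (le_trans (sum_words_tilt _ _ _ _ _)) ?invr_gt0 -1?ltnS // invrK addrC.
Qed.

(** * Powers of two *)

Lemma pow2_gt0 {R : realType} (x : R) : 0 < 2 `^ x.
Proof. exact: powR_gt0. Qed.

Lemma pow2D {R : realType} (x y : R) : 2 `^ (x + y) = 2 `^ x * 2 `^ y.
Proof. by rewrite powRD // pnatr_eq0 implybT. Qed.

Lemma ln2_gt0 {R : realType} : 0 < ln (2 : R).
Proof. by rewrite ln_gt0 // ltr1n. Qed.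

Lemma ltr_pow2 {R : realType} (x y : R) : (2 `^ x < 2 `^ y) = (x < y).
Proof. by rewrite /powR pnatr_eq0 /= ltr_expR ltr_pM2r ?ln2_gt0. Qed.

Lemma ler_pow2 {R : realType} (x y : R) : (2 `^ x <= 2 `^ y) = (x <= y).
Proof. by rewrite !leNgt ltr_pow2. Qed.

Lemma pow2_logb {R : realType} {x : R} : 0 < x -> 2 `^ (logb 2 x) = x.
Proof.
move=> x0; rewrite /powR pnatr_eq0 /= /logb divfK ?lnK ?posrE //.
by rewrite gt_eqF ?ln2_gt0.
Qed.

Lemma pow2_logbM {R : realType} {x : R} n : 0 < x -> 2 `^ (logb 2 x * n%:R) = x ^+ n.
Proof. by move=> x0; rewrite powRrM pow2_logb // powR_mulrn // ltW. Qed.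

Lemma pow2n {R : realType} n : 2 `^ n%:R = (2 ^ n)%:R :> R.
Proof. by rewrite powR_mulrn // natrX. Qed.

Lemma pow3n {R : realType} n : 2 `^ (logb 2 3 * n%:R) = (3 ^ n)%:R :> R.
Proof. by rewrite pow2_logbM // natrX. Qed.

Lemma logb23_gt1 {R : realType} : 1 < logb 2 3 :> R.
Proof. by rewrite -ltr_pow2 pow2_logb // powRr1 // ltr_nat. Qed.

Lemma logb23_lt2 {R : realType} : logb 2 3 < 2 :> R.
Proof. by rewrite -ltr_pow2 pow2_logb // powR_mulrn // -natrX ltr_nat. Qed.

(** Polynomial losses are absorbed by arbitrarily small exponential ones. *)
Lemma linear_le_pow2 {R : realType} (a delta : R) : 0 < delta ->
  exists q0, forall q, (q0 <= q)%N -> a * (q%:R + 1) <= 2 `^ (delta * q%:R).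
Proof.
move=> d0; pose t : R := delta * ln 2 / 2.
have t0 : 0 < t by rewrite divr_gt0 // mulr_gt0 // ln2_gt0.
exists (maxn (Num.truncn (a / t ^+ 2)).+1 (Num.truncn (a / (2 * t))).+1) => q.
rewrite geq_max => /andP[h1 h2].
have {}h1 : a <= q%:R * t ^+ 2.
  rewrite -ler_pdivrMr ?exprn_gt0 //; apply/ltW/(lt_le_trans (truncnS_gt _)).
  rewrite ler_nat; exact: h1.
have {}h2 : a <= q%:R * (2 * t).
  rewrite -ler_pdivrMr ?(mulr_gt0 (ltr0Sn R 1) t0) //; apply/ltW/(lt_le_trans (truncnS_gt _)).
  rewrite ler_nat; exact: h2.
rewrite /powR pnatr_eq0 /= (_ : _ * _ * _ = t * q%:R + t * q%:R); last by rewrite /t; field.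
rewrite expRD; have e1 := expR_ge1Dx (t * q%:R).
have q0 : 0 <= q%:R :> R by rewrite ler0n.
have tq : 0 <= t * q%:R by rewrite mulr_ge0 // ltW.
apply: le_trans (_ : (1 + t * q%:R) * (1 + t * q%:R) <= _); last first.
  by rewrite ler_pM // addr_ge0.
have := ler_wpM2r q0 h1; nra.
Qed.

(** * Sparse sets *)

(** The saving is measured on dyadic blocks because all m of a block have the same
    q(m), so that the map m |-> T^(q(m))(m) is a fixed iterate there. *)
Definition sparse (R : realType) (S : pred nat) : Prop :=
  exists c C : R, [/\ 0 < c, c <= 1 &
    forall q, (count S (block q))%:R <= C * 2 `^ ((1 - c) * q%:R)].

Lemma size_block q : size (block q) = (2 ^ q)%N.
Proof. by rewrite size_iota expnS; lia. Qed.

Lemma trunc_log_block {q m} : m \in block q -> trunc_log 2 m = q.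
Proof. by rewrite mem_block => /trunc_log_eq; apply. Qed.

(** Finitely many blocks only affect the constant. *)
Lemma count_le_eventually {R : realType} {f : nat -> nat} {c C : R} {q0} :
  0 < c <= 1 -> (forall q, (f q <= 2 ^ q)%N) ->
  (forall q, (q0 <= q)%N -> (f q)%:R <= C * 2 `^ ((1 - c) * q%:R)) ->
  exists C' : R, forall q, (f q)%:R <= C' * 2 `^ ((1 - c) * q%:R).
Proof.
move=> /andP[c0 c1] f2 H; exists (`|C| + (2 ^ q0)%:R) => q.
have p0 := pow2_gt0 ((1 - c) * q%:R).
have [/H h|/ltnW lt] := leqP q0 q.
  apply: (le_trans h); rewrite ler_wpM2r ?(ltW p0) // (le_trans (ler_norm _)) //.
  by rewrite lerDl ler0n.
apply: le_trans (_ : (2 ^ q0)%:R * 1 <= _).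
  by rewrite mulr1 ler_nat (leq_trans (f2 q)) // leq_exp2l.
apply: ler_pM => //; first by rewrite lerDr.
by rewrite -[leLHS](powRr0 2) ler_pow2 mulr_ge0 // subr_ge0.
Qed.

Lemma count_block_leq (S : pred nat) q : (count S (block q) <= 2 ^ q)%N.
Proof. by rewrite -(size_block q) count_size. Qed.

Lemma sparse_eventually {R : realType} {S : pred nat} (c C : R) q0 : 0 < c <= 1 ->
  (forall q, (q0 <= q)%N -> (count S (block q))%:R <= C * 2 `^ ((1 - c) * q%:R)) ->
  sparse R S.
Proof.
move=> c01 /(count_le_eventually c01 (count_block_leq S))[C' H].
by case/andP: c01 => c0 c1; exists c, C'.
Qed.

Lemma sparse_sub {R : realType} {S S' : pred nat} q0 :
  (forall m, (0 < m)%N -> (q0 <= trunc_log 2 m)%N -> S m -> S' m) ->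
  sparse R S' -> sparse R S.
Proof.
move=> sub [c [C [c0 c1 H]]]; apply: (@sparse_eventually R _ c C q0); first by rewrite c0.
move=> q leq; apply: le_trans (H q); rewrite ler_nat.
rewrite (@eq_in_count _ _ (fun m => (m \in block q) && S m)); last by move=> m /= ->.
apply: sub_count => m /= /andP[mb]; apply: sub; first exact: block_gt0 mb.
by rewrite (trunc_log_block mb).
Qed.

Lemma sparse_bound_ge0 {R : realType} {S : pred nat} {c C : R} :
  (forall q, (count S (block q))%:R <= C * 2 `^ ((1 - c) * q%:R)) -> 0 <= C.
Proof. by move=> /(_ 0%N); rewrite mulr0 powRr0 mulr1; apply: le_trans. Qed.

Lemma sparseU {R : realType} {S S' : pred nat} :
  sparse R S -> sparse R S' -> sparse R (predU S S').
Proof.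
move=> [c [C [c0 c1 H]]] [c' [C' [c'0 c'1 H']]].
exists (Num.min c c'), (C + C'); split; first by rewrite lt_min c0.
  by rewrite ge_min c1.
move=> q; have := count_predUI S S' (block q).
move=> /(congr1 (GRing.natmul (1 : R))); rewrite !natrD => E.
rewrite mulrDl; apply: le_trans (_ : (count S (block q))%:R + (count S' (block q))%:R <= _).
  by rewrite -E lerDl.
have mono (d : R) : Num.min c c' <= d ->
    2 `^ ((1 - d) * q%:R) <= 2 `^ ((1 - Num.min c c') * q%:R).
  by move=> h; rewrite ler_pow2 ler_wpM2r // lerB.
apply: lerD; [apply: le_trans (H q) _|apply: le_trans (H' q) _].
  by rewrite ler_wpM2l ?(sparse_bound_ge0 H) // mono // ge_min lexx.
by rewrite ler_wpM2l ?(sparse_bound_ge0 H') // mono // ge_min lexx orbT.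
Qed.

(** With lam = 1 + eta, the Chernoff bound is 2^q ((1 + eta^2/2) / lam^delta)^q up to
    a factor linear in q.  For small eta the gain lam^delta = 1 + delta eta + ...
    beats the loss 1 + eta^2/2, which is quadratic. *)
Lemma unbalanced_words_sparse {R : realType} (delta : R) : 0 < delta ->
  exists c C : R, [/\ 0 < c, c <= 1 & forall q,
    (count (predC (balanced (Num.truncn (delta * q%:R)))) (words q))%:R
      <= C * 2 `^ ((1 - c) * q%:R)].
Proof.
move=> d0; pose eta := Num.min delta 1 / 2 : R.
have eta0 : 0 < eta by rewrite divr_gt0 // lt_min d0 /=.
have [etad eta1] : eta < delta /\ eta < 1.
  have h1 : Num.min delta 1 <= delta by rewrite ge_min lexx.
  have h2 : Num.min delta 1 <= 1 by rewrite ge_min lexx orbT.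
  by rewrite /eta; split; lra.
pose lam := 1 + eta.
have lam1 : 1 <= lam by rewrite /lam; lra.
have lam0 : 0 < lam by lra.
have lamV : lam + lam^-1 <= 2 * (1 + eta ^+ 2 / 2).
  rewrite -subr_ge0 (_ : _ - _ = eta ^+ 3 / lam); last by rewrite /lam; field; rewrite gt_eqF.
  by rewrite divr_ge0 // ?exprn_ge0 // ltW.
have x0 : 0 < 1 + eta ^+ 2 / 2 by have := exprn_gt0 2 eta0; lra.
(* The exponential rate at which the Chernoff bound saves. *)
pose c0 := delta * logb 2 lam - logb 2 (1 + eta ^+ 2 / 2).
have c00 : 0 < c0.
  rewrite /c0 /logb mulrA -mulrBl divr_gt0 ?ln2_gt0 // subr_gt0.
  have u : ln (1 + eta ^+ 2 / 2) <= eta ^+ 2 / 2.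
    by apply: le_ln1Dx; have := exprn_gt0 2 eta0; lra.
  have v : ln (1 - eta / lam) <= - (eta / lam).
    apply: le_ln1Dx; rewrite ltrN2 ltr_pdivrMr // /lam; lra.
  have w : 1 - eta / lam = lam^-1 by rewrite /lam; field; rewrite gt_eqF.
  rewrite w lnV ?posrE // lerN2 in v.
  apply: le_lt_trans u _; apply: (@lt_le_trans _ _ (delta * (eta / lam))); last first.
    by rewrite ler_pM2l.
  rewrite mulrA ltr_pdivlMr // /lam; nra.
pose c := Num.min (c0 / 2) 1.
have c01 : 0 < c <= 1.
  by rewrite /c lt_min ge_min divr_gt0 //= lexx orbT ltr01.
have [q0 H0] := linear_le_pow2 1 _ (divr_gt0 c00 (ltr0Sn R 1)).
have [||C HC] := @count_le_eventually R
  (fun q => count (predC (balanced (Num.truncn (delta * q%:R)))) (words q)) c 2 q0 c01.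
- by move=> q; rewrite -(size_words q) count_size.
- move=> q /H0; rewrite mul1r => hq.
  set D := Num.truncn _.
  have := count_unbalanced_words lam D q lam1.
  rewrite -ler_pdivlMr ?exprn_gt0 // => /le_trans; apply.
  have e1 : (lam + lam^-1) ^+ q <= 2 `^ (q%:R + logb 2 (1 + eta ^+ 2 / 2) * q%:R).
    rewrite pow2D pow2_logbM // powR_mulrn // -exprMn lerXn2r // nnegrE.
      by rewrite addr_ge0 // ltW // invr_gt0.
    by rewrite mulr_ge0 // ltW.
  have e2 : 2 `^ (logb 2 lam * (delta * q%:R)) <= lam ^+ D.+1.
    rewrite -pow2_logbM // ler_pow2 ler_wpM2l //; last exact: ltW (truncnS_gt _).
    by rewrite divr_ge0 // ln_ge0 // ler1n.
  rewrite ler_pdivrMr ?exprn_gt0 //.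
  apply: (@le_trans _ _ (2 * 2 `^ ((1 - c) * q%:R) * 2 `^ (logb 2 lam * (delta * q%:R)))); last first.
    by rewrite ler_wpM2l // mulr_ge0 // ltW // pow2_gt0.
  rewrite mulrCA -mulrA ler_wpM2l // -pow2D.
  rewrite -natr1.
  apply: (@le_trans _ _ (2 `^ (c0 / 2 * q%:R) * 2 `^ (q%:R + logb 2 (1 + eta ^+ 2 / 2) * q%:R))).
    apply: ler_pM => //; rewrite exprn_ge0 // addr_ge0 // ltW // invr_gt0 //.
  rewrite -pow2D ler_pow2.
  have : c * q%:R <= c0 / 2 * q%:R by rewrite ler_wpM2r // /c ge_min lexx.
  by rewrite /c0; lra.
by exists c, C; case/andP: c01.
Qed.

(** * Sparse sets are pulled back to sparse sets *)

Lemma sum_blocks_leq {R : realType} {S : pred nat} {c C : R} Q : c <= 1 ->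
  (forall q, (count S (block q))%:R <= C * 2 `^ ((1 - c) * q%:R)) ->
  (\sum_(i < Q) count S (block i))%:R <= Q%:R * (C * 2 `^ ((1 - c) * Q%:R)).
Proof.
move=> c1 H; rewrite natr_sum.
rewrite (_ : Q%:R * _ = \sum_(i < Q) C * 2 `^ ((1 - c) * Q%:R)); last first.
  by rewrite sumr_const card_ord mulr_natl.
apply: ler_sum => i _; apply: le_trans (H i) _.
rewrite ler_wpM2l ?(sparse_bound_ge0 H) // ler_pow2 ler_wpM2l ?subr_ge0 //.
by rewrite ler_nat ltnW.
Qed.

(** The balanced part of the preimage in a block has at most
    2^q / 3^(q/2) times 3^(q/2 (1-c)) elements, up to a factor 2^(O(delta) q).
    The saving 3^(-cq/2) remains if delta is a small multiple of c. *)
Lemma sparse_pullback {R : realType} {S : pred nat} : sparse R S ->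
  sparse R (fun m => S (iter (trunc_log 2 m) terras m)).
Proof.
move=> [c [C [c0 c1 HS]]]; pose delta : R := c / 56.
have d0 : 0 < delta by rewrite divr_gt0.
have [b [B [b0 b1 HB]]] := unbalanced_words_sparse delta d0.
have [q0 H0] := linear_le_pow2 2 delta d0.
have C0 := sparse_bound_ge0 HS.
have B0 : 0 <= B.
  by have := HB 0%N; rewrite !mulr0 powRr0 mulr1; apply: le_trans.
pose e := Num.min b (c / 4).
have e01 : 0 < e <= 1.
  by rewrite /e lt_min ge_min b0 b1 divr_gt0.
apply: (@sparse_eventually R _ e (B + C) q0 e01) => q /H0 hq {H0}.
pose D := Num.truncn (delta * q%:R).
have l1 := @logb23_gt1 R; have l2 := @logb23_lt2 R.
set l := logb 2 3 in l1 l2.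
have qR0 : 0 <= q%:R :> R by [].
have dq0 : 0 <= delta * q%:R by rewrite mulr_ge0 // ltW.
have dq1 : 1 <= delta * q%:R.
  rewrite -ler_pow2 powRr1 //; apply: le_trans hq; lra.
have hD : D%:R <= delta * q%:R by rewrite truncn_le.
have lD : l * D%:R <= 2 * (delta * q%:R) by rewrite ler_pM // ltW //; lra.
have lq1 : q%:R <= l * q%:R by rewrite ler_peMl // ltW.
have lq2 : l * q%:R <= 2 * q%:R by rewrite ler_wpM2r // ltW.
have dq : delta * q%:R <= q%:R / 56.
  by rewrite /delta mulrAC ler_pM2r // ler_piMl.
(* [r] and [Q] lie on the two sides of q log_2(3) / 2, at a distance which lets
   [cond1] and [cond2] absorb the factors 27^D, 3^(3D) and the squares. *)
pose r := Num.truncn (l * q%:R / 2 - 5 * (delta * q%:R)).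
have r0 : 0 <= l * q%:R / 2 - 5 * (delta * q%:R) by lra.
have /andP[r1 r2] := truncn_itv r0; rewrite -/r -[r.+1%:R]natr1 in r1 r2.
pose Q := (Num.truncn (l * q%:R / 2 + 5 * (delta * q%:R))).+1.
have Q0 : 0 <= l * q%:R / 2 + 5 * (delta * q%:R) by lra.
have /andP[Q1 Q2] := truncn_itv Q0; rewrite -/Q in Q1 Q2.
have {}Q1 : Q%:R <= l * q%:R / 2 + 6 * (delta * q%:R) by rewrite /Q -natr1; lra.
have lerq : (r <= q)%N by rewrite -(ler_nat R); lra.
rewrite (@eq_in_count _ _ (fun m => S (iter q terras m))); last first.
  by move=> m /trunc_log_block ->.
have cond1 : ((r * 2 ^ r) ^ 2 * 27 ^ D < 3 ^ q)%N.
  rewrite -(ltr_nat R) natrM (natrX _ _ 2) natrM (_ : 27 = 3 ^ 3)%N // -expnM -!pow3n -pow2n -/l.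
  apply: (@le_lt_trans _ _ ((2 `^ (delta * q%:R) * 2 `^ r%:R) ^+ 2 * 2 `^ (l * (3 * D)%:R))).
    rewrite ler_wpM2r ?powR_ge0 //.
    rewrite lerXn2r ?nnegrE ?mulr_ge0 ?powR_ge0 //.
    rewrite ler_wpM2r ?powR_ge0 //; apply: le_trans hq; lra.
  rewrite expr2 -!pow2D ltr_pow2 natrM; lra.
have cond2 : (q.+2 ^ 2 * 3 ^ (q + 3 * D) < 4 ^ Q)%N.
  rewrite -(ltr_nat R) natrM (natrX _ _ 2) (_ : 4 = 2 ^ 2)%N // -expnM -pow3n -pow2n -/l.
  apply: (@le_lt_trans _ _ ((2 `^ (delta * q%:R)) ^+ 2 * 2 `^ (l * (q + 3 * D)%:R))).
    rewrite ler_wpM2r ?powR_ge0 //.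
    rewrite lerXn2r ?nnegrE ?powR_ge0 //.
    apply: le_trans hq; rewrite -[q.+2%:R]natr1 -[q.+1%:R]natr1; lra.
  rewrite expr2 -!pow2D ltr_pow2 natrM natrD natrM; lra.
have := count_pullback S lerq cond1 cond2; rewrite -(ler_nat R) => /le_trans; apply.
rewrite natrD mulrDl lerD //.
  apply: le_trans (_ : B * 2 `^ ((1 - b) * q%:R) <= _).
    apply: le_trans (HB q); rewrite ler_nat; exact: (count_block_words (predC (balanced D))).
  by rewrite ler_wpM2l // ler_pow2 ler_wpM2r // lerB // /e ge_min lexx.
rewrite !natrM -pow2n natrB //.
apply: le_trans (_ : 2 `^ (q%:R - r%:R) * 2 `^ (delta * q%:R) *
  (2 `^ (delta * q%:R) * (C * 2 `^ ((1 - c) * Q%:R))) <= _).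
  apply: ler_pM => //.
  - by rewrite ler_wpM2l ?powR_ge0 // -[r.+1%:R]natr1; apply: le_trans hq; lra.
  apply: le_trans (sum_blocks_leq Q c1 HS) _.
  rewrite ler_wpM2r ?mulr_ge0 ?powR_ge0 //; apply: le_trans hq; lra.
rewrite (_ : _ * _ * _ = C * (2 `^ (q%:R - r%:R) * 2 `^ (delta * q%:R) *
  2 `^ (delta * q%:R) * 2 `^ ((1 - c) * Q%:R))); last by ring.
(* The exponent loses 14 delta q = c q / 4 and gains c l q / 2 >= c q / 2. *)
rewrite ler_wpM2l // -!pow2D ler_pow2.
have eq : e * q%:R <= c / 4 * q%:R by rewrite ler_wpM2r // /e ge_min lexx orbT.
have cQ : (1 - c) * Q%:R <= (1 - c) * (l * q%:R / 2 + 6 * (delta * q%:R)).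
  by rewrite ler_wpM2l // subr_ge0.
have clq : c * q%:R <= c * (l * q%:R) by rewrite ler_wpM2l // ltW.
have cdq : 0 <= c * (delta * q%:R) by rewrite mulr_ge0 // ltW.
have d56 : c * q%:R = 56 * (delta * q%:R) by rewrite /delta; field.
lra.
Qed.

(** * Control of the drift *)

Definition drifting {R : realType} (kappa eps : R) : pred nat := fun m =>
  `[< exists j : nat, j%:R <= kappa * (trunc_log 2 m)%:R /\
      eps * (trunc_log 2 m)%:R < `|2 * (odds j m)%:R - j%:R| >].

Lemma driftingPn {R : realType} {kappa eps : R} {m} : ~~ drifting kappa eps m ->
  forall j : nat, j%:R <= kappa * (trunc_log 2 m)%:R ->
  `|2 * (odds j m)%:R - j%:R| <= eps * (trunc_log 2 m)%:R.
Proof.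
move=> /asboolPn nb j le; rewrite leNgt; apply/negP => lt.
by apply: nb; exists j.
Qed.

Lemma drifting1_sparse {R : realType} (eps : R) : 0 < eps -> sparse R (drifting 1 eps).
Proof.
move=> e0; have [c [C [c0 c1 H]]] := unbalanced_words_sparse eps e0.
exists c, C; split => // q; apply: le_trans (H q); rewrite ler_nat.
apply: leq_trans (count_block_words _ q).
rewrite (@eq_in_count _ (drifting 1 eps) (fun m => (m \in block q) && drifting 1 eps m)); last first.
  by move=> m /= ->.
apply: sub_count => m /= /andP[mb]; apply: contraLR; rewrite negbK => /balancedP g.
apply/asboolPn => -[j []]; rewrite (trunc_log_block mb) mul1r ler_nat => le; apply/negP.
rewrite -leNgt; have [g1 g2] := g j le.
have e := truncn_le (eps * q%:R); rewrite mulr_ge0 // ?(ltW e0) // in e.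
move: g1; rewrite -(ler_nat R) natrD natrM => g1.
move: g2; rewrite -(ler_nat R) natrD natrM => g2.
by rewrite ler_norml; apply/andP; split; lra.
Qed.

Lemma trunc_log_logb {R : realType} {m : nat} : (0 < m)%N ->
  (trunc_log 2 m)%:R <= logb 2 (m%:R : R) < (trunc_log 2 m).+1%:R.
Proof.
move=> m0; rewrite -ler_pow2 -ltr_pow2 pow2_logb ?ltr0n // !pow2n.
by rewrite ler_nat ltr_nat trunc_logP // trunc_log_ltn.
Qed.

(** If m does not drift during the first q(m) steps, then y = T^(q(m))(m) is about
    3^(q(m)/2), so that q(y) >= mu q(m).  If y does not drift during its first
    kappa q(y) steps either, the two drifts add up. *)
Lemma drifting_step {R : realType} (kappa mu : R) :
  0 <= kappa -> 0 < mu -> mu < logb 2 3 / 2 ->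
  (forall eps, 0 < eps -> sparse R (drifting kappa eps)) ->
  forall eps, 0 < eps -> sparse R (drifting (1 + kappa * mu) eps).
Proof.
move=> k0 mu0 mul H eps e0; set l := logb 2 3 in mul.
have l1 := @logb23_gt1 R; have l2 := @logb23_lt2 R; rewrite -/l in l1 l2.
pose delta := Num.min (eps / 2) ((l / 2 - mu) / 2).
have [d0 de dl] : [/\ 0 < delta, delta <= eps / 2 & delta <= (l / 2 - mu) / 2].
  by rewrite /delta lt_min !ge_min !lexx orbT; split => //; apply/andP; split; lra.
pose gap := l / 2 - mu.
apply: (@sparse_sub R _ _ (Num.truncn (2 / gap)).+1 _
  (sparseU (drifting1_sparse delta d0) (sparse_pullback (H (eps / 4) _)))); last by lra.
move=> m m0 qge; apply: contraLR; rewrite /= negb_or => /andP[/driftingPn n1 /driftingPn n2].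
set q := trunc_log 2 m in qge n1 n2; set y := iter q terras m in n2.
have y0 : (0 < y)%N by apply: iter_terras_gt0.
have gap0 : 0 < gap by rewrite /gap; lra.
have {}qge : 2 <= gap * q%:R.
  rewrite mulrC -ler_pdivrMr //; apply/ltW/(lt_le_trans (truncnS_gt _)).
  by rewrite ler_nat.
have qy2 : (trunc_log 2 y)%:R <= 2 * q%:R :> R.
  rewrite -natrM ler_nat -ltnS -(@ltn_exp2l 2) //.
  apply: leq_ltn_trans (trunc_logP _ y0) _ => //.
  apply: leq_ltn_trans (iter_terras_leq q m) _.
  have lm : (m < 2 ^ q.+1)%N by apply: trunc_log_ltn.
  rewrite (_ : (2 * q).+1 = q + q.+1)%N; last by rewrite addnS addnn mul2n.
  rewrite expnD; apply: leq_ltn_trans (_ : 2 ^ q * m < _)%N.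
    by rewrite leq_mul2r leq_exp2l ?odds_leq ?orbT.
  by rewrite ltn_pmul2l ?expn_gt0.
have n1q : forall j, (j <= q)%N -> `|2 * (odds j m)%:R - j%:R| <= delta * q%:R.
  by move=> j le; apply: n1; rewrite mul1r ler_nat.
have qy1 : mu * q%:R <= (trunc_log 2 y)%:R.
  have /ler_normlP[lo _] := n1q q (leqnn q).
  have y3 : (3 ^ odds q m <= y)%N.
    rewrite -(@leq_pmul2l (2 ^ q)) ?expn_gt0 // iter_terrasE.
    apply: leq_trans (leq_addr _ _); rewrite mulnC leq_mul2l.
    by rewrite trunc_logP // orbT.
  have : (3 ^ odds q m < 2 ^ (trunc_log 2 y).+1)%N.
    by apply: leq_ltn_trans y3 _; apply: trunc_log_ltn.
  rewrite -(ltr_nat R) -pow3n -pow2n ltr_pow2 -/l -[_.+1%:R]natr1 => h.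
  have h1 : l * (q%:R - delta * q%:R) <= l * (2 * (odds q m)%:R).
    by rewrite ler_wpM2l; lra.
  have h2 : l * (delta * q%:R) <= 2 * (delta * q%:R).
    by rewrite ler_wpM2r ?mulr_ge0 // ltW.
  have h3 : delta * q%:R <= gap / 2 * q%:R by rewrite ler_wpM2r.
  rewrite /gap in h3 qge; lra.
apply/asboolPn => -[j []]; rewrite -/q => jle; apply/negP; rewrite -leNgt.
have dq : delta * q%:R <= eps / 2 * q%:R by rewrite ler_wpM2r.
have [lejq|/ltnW leqj] := leqP j q.
  apply: le_trans (n1q j lejq) _; have : 0 <= eps / 2 * q%:R by rewrite mulr_ge0 // divr_ge0 // ltW.
  lra.
rewrite -(subnKC leqj) in jle *.
move: (j - q)%N jle => {leqj}j; rewrite oddsD !natrD -/y => jle.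
have /ler_normlP[a1 a2] := n1q q (leqnn q).
have : `|2 * (odds j y)%:R - j%:R| <= eps / 4 * (trunc_log 2 y)%:R.
  apply: n2; apply: (@le_trans _ _ (kappa * (mu * q%:R))); first by lra.
  by rewrite ler_wpM2l.
have : eps / 4 * (trunc_log 2 y)%:R <= eps / 4 * (2 * q%:R).
  by rewrite ler_wpM2l // divr_ge0 // ltW.
move=> b /ler_normlP[b1 b2].
by rewrite ler_norml; apply/andP; split; lra.
Qed.

Lemma drifting_mono {R : realType} (kappa kappa' eps : R) : kappa <= kappa' ->
  sparse R (drifting kappa' eps) -> sparse R (drifting kappa eps).
Proof.
move=> le; apply: (@sparse_sub R _ _ 0%N) => m _ _ /asboolP[j [j1 j2]].
apply/asboolP; exists j; split => //; apply: le_trans j1 _.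
by rewrite ler_wpM2r.
Qed.

(** Iterates [drifting_step] from 0 with one mu, so close to (log_2 3)/2 that
    1/(1 - mu) exceeds kappa.  The hypothesis on kappa reads
    kappa < 2 / log_2(4/3). *)
Lemma drifting_sparse {R : realType} (kappa eps : R) :
  0 < eps -> kappa * (2 - logb 2 3) < 2 -> sparse R (drifting kappa eps).
Proof.
move=> e0; set l := logb 2 3 => hk.
have l1 := @logb23_gt1 R; have l2 := @logb23_lt2 R; rewrite -/l in l1 l2.
have [k1|k1] := leP kappa 1; first exact: drifting_mono k1 (drifting1_sparse _ e0).
(* Such a [mu] is chosen midway between l / 2 and 1 - 1 / kappa; the maximum with
   1 / 4 keeps it positive. *)
have [mu [mu0 mul hmu]] : exists mu, [/\ 0 < mu, mu < l / 2 & kappa * (1 - mu) < 1].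
  exists (Num.max (1 / 4) ((l / 2 + (1 - kappa^-1)) / 2)).
  have kV : kappa * kappa^-1 = 1 by rewrite divff // gt_eqF //; lra.
  have l2k : 1 - kappa^-1 < l / 2.
    have : kappa * (1 - l / 2) < kappa * kappa^-1 by rewrite kV; lra.
    by rewrite ltr_pM2l; lra.
  split; first by rewrite lt_max divr_gt0.
    by rewrite gt_max; apply/andP; split; lra.
  have h : (l / 2 + (1 - kappa^-1)) / 2 <= Num.max (1 / 4) ((l / 2 + (1 - kappa^-1)) / 2).
    by rewrite le_max lexx orbT.
  set mu := Num.max _ _ in h *.
  have : kappa * (1 - mu) < kappa * kappa^-1 by rewrite ltr_pM2l; lra.
  by rewrite kV.
have iterate n : forall e, 0 < e -> sparse R (drifting ((1 - mu ^+ n) / (1 - mu)) e).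
  elim: n => [|n IH] e e_gt0.
    apply: drifting_mono (drifting1_sparse _ e_gt0).
    by rewrite expr0 subrr mul0r.
  have -> : (1 - mu ^+ n.+1) / (1 - mu) = 1 + (1 - mu ^+ n) / (1 - mu) * mu.
    by rewrite exprS; field; rewrite gt_eqF //; lra.
  apply: drifting_step => //; rewrite divr_ge0 //; last by lra.
  by rewrite subr_ge0 exprn_ile1 //; lra.
have [n hn] : exists n, mu ^+ n <= 1 - kappa * (1 - mu).
  have : (fun n => mu ^+ n) @ \oo --> (0 : R) by apply: cvg_expr; rewrite ger0_norm; lra.
  move=> /cvgr_le/(_ (1 - kappa * (1 - mu)) _)[|n _ hn]; first by lra.
  by exists n; apply: hn => /=.
apply: drifting_mono (iterate n _ e0).
rewrite ler_pdivlMr; lra.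
Qed.

(** * From the Terras map to the Syracuse map *)

Lemma iter_terras_pow2 j n :
  iter j terras (2 ^ j * n)%N = n /\ odds j (2 ^ j * n)%N = 0%N.
Proof.
elim: j => [|j [IH1 IH2]]; first by rewrite mul1n.
have ev : odd (2 ^ j.+1 * n)%N = false by rewrite oddM oddX.
have tE : terras (2 ^ j.+1 * n)%N = (2 ^ j * n)%N.
  by rewrite /terras ev expnS -mulnA mul2n doubleK.
by rewrite iterSr tE IH1 /odds /= ev tE -/(odds _ _) IH2.
Qed.

Lemma Syr_terras {m} : odd m ->
  exists s, iter s terras m = Syr m /\ odds s m = 1%N.
Proof.
move=> om; rewrite /Syr addn1.
have [n n_odd e] := pfactor_coprime (isT : prime 2) (ltn0Sn (3 * m)).
set v := logn 2 _ in e *.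
have v0 : (0 < v)%N by rewrite logn_gt0 mem_primes /= dvdn2 /= oddM om.
exists v; rewrite [X in (X %/ _)%N]e mulnK ?expn_gt0 //.
have tE : terras m = (2 ^ v.-1 * n)%N.
  rewrite /terras om addn1 e -(prednK v0) expnS mulnCA mul2n doubleK.
  by rewrite mulnC.
have [i o] := iter_terras_pow2 v.-1 n.
rewrite -(prednK v0) iterSr /= tE i /odds /= om tE -/(odds _ _) o.
by [].
Qed.

Lemma iter_Syr_terras k {m} : odd m -> odd (iter k Syr m) /\
  exists s, iter s terras m = iter k Syr m /\ odds s m = k.
Proof.
move=> om; elim: k => [|k [ok [s [sT so]]]]; first by split=> //; exists 0%N.
split; first exact: Syr_Dplus.
have [t [tT to]] := Syr_terras ok.
by exists (s + t)%N; rewrite addnC iterD sT tT addnC oddsD so sT to addn1.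
Qed.

(** The offset divided by 3^(odds j m) is the sum of 2^i / 3^(odds (i+1) m) over the
    odd positions i < j. *)
Lemma offset_drift {R : realType} {B : R} {j m} : 0 <= B ->
  (forall i, (i < j)%N -> (2 ^ i)%:R <= B * (3 ^ odds i m)%:R) ->
  (offset (parities j m))%:R <= j%:R * B * (3 ^ odds j m)%:R.
Proof.
move=> B0; elim: j => [|j IH] H; first by rewrite !mul0r.
have {}IH := IH (fun i lt => H i (ltnW lt)); have {}H := H j (ltnSn j).
rewrite -[j.+1]addn1 parities_cat offset_cat oddsD size_parities /odds /= -/(odds j m).
rewrite natrD natrM [X in _ + X]natrM expnD natrM [(j + 1)%:R]natrD.
set O := (3 ^ odds j m)%:R in IH H *.
have O0 : 0 <= O by [].
have jB : 0 <= j%:R * B * O by rewrite !mulr_ge0.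
have BO : 0 <= B * O by rewrite mulr_ge0.
case: (odd _); rewrite /= ?expn0 ?expn1 ?muln1 ?addn0 ?add0n ?mulr1 ?mulr0 ?expnD ?natrM -/O; lra.
Qed.

Lemma pow2_le_iter_terras {R : realType} j {m} : (0 < m)%N ->
  2 `^ (logb 2 3 * (odds j m)%:R - j%:R + logb 2 m%:R) <= (iter j terras m)%:R :> R.
Proof.
move=> m0; have p0 := pow2_gt0 (j%:R : R).
rewrite -(ler_pM2l p0) -pow2D [X in 2 `^ X](_ : _ = logb 2 3 * (odds j m)%:R + logb 2 m%:R); last by ring.
rewrite pow2D pow3n pow2_logb ?ltr0n // pow2n -!natrM ler_nat iter_terrasE.
exact: leq_addr.
Qed.

(** The offset divided by 3^(odds j m) is at most the sum over i < j of the terms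
    2^i / 3^(odds i m).  These are about (4/3)^(i/2), which is at most 2^(q(m))
    precisely when i log_2(4/3) <= 2 q(m).  So the offset does not exceed
    3^(odds j m) m by more than a factor 2^(O(e) q(m)). *)
Lemma iter_terras_le_pow2 {R : realType} {kappa e : R} {j m} : (0 < m)%N ->
  0 < e -> 0 <= kappa -> kappa * (2 - logb 2 3) <= 2 ->
  ~~ drifting kappa e m -> j%:R <= kappa * (trunc_log 2 m)%:R ->
  1 + kappa * (trunc_log 2 m)%:R <= 2 `^ (e * (trunc_log 2 m)%:R) ->
  (iter j terras m)%:R <=
    2 `^ (logb 2 3 * (odds j m)%:R - j%:R + logb 2 m%:R + 2 * e * (trunc_log 2 m)%:R).
Proof.
move=> m0 e0 k0 kh /driftingPn nb jk; have /andP[qm _] := @trunc_log_logb R _ m0.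
set q := trunc_log 2 m in nb jk qm *; set l := logb 2 3 in kh *; set lm := logb 2 _ in qm *.
have l1 := @logb23_gt1 R; have l2 := @logb23_lt2 R; rewrite -/l in l1 l2.
move=> poly.
have eq0 : 0 <= e * q%:R by rewrite mulr_ge0 // ltW.
pose B : R := 2 `^ (q%:R + e * q%:R).
have off : (offset (parities j m))%:R <= j%:R * B * (3 ^ odds j m)%:R.
  apply: offset_drift; first exact: powR_ge0.
  move=> i lt; rewrite -pow3n -pow2n -pow2D ler_pow2 -/l.
  have ik : i%:R <= kappa * q%:R by apply: le_trans jk; rewrite ler_nat ltnW.
  have /ler_normlP[lo _] := nb i ik.
  have h1 : l * i%:R - l * (e * q%:R) <= 2 * (l * (odds i m)%:R).
    have h0 : i%:R - e * q%:R <= 2 * (odds i m)%:R by lra.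
    have : l * (i%:R - e * q%:R) <= l * (2 * (odds i m)%:R) by rewrite ler_wpM2l //; lra.
    lra.
  have h2 : (2 - l) * i%:R <= (2 - l) * (kappa * q%:R) by rewrite ler_wpM2l //; lra.
  have h3 : kappa * (2 - l) * q%:R <= 2 * q%:R by rewrite ler_wpM2r.
  have h4 : l * (e * q%:R) <= 2 * (e * q%:R) by rewrite ler_wpM2r // ltW.
  lra.
rewrite -(ler_pM2l (pow2_gt0 j%:R)) -pow2D {1}pow2n -natrM iter_terrasE natrD natrM.
apply: le_trans (lerD (lexx _) off) _.
rewrite mulrC -mulrDl -pow3n -/l -{1}(pow2_logb (_ : 0 < m%:R)) ?ltr0n // -/lm.
have jB : j%:R * B <= kappa * q%:R * 2 `^ (lm + e * q%:R).
  by rewrite ler_pM ?powR_ge0 // ler_pow2 lerD2r.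
have mE : 2 `^ lm <= 2 `^ (lm + e * q%:R) by rewrite ler_pow2 lerDl.
apply: (@le_trans _ _ ((1 + kappa * q%:R) * 2 `^ (lm + e * q%:R) * 2 `^ (l * (odds j m)%:R))).
  by rewrite ler_wpM2r ?powR_ge0 //; lra.
apply: (@le_trans _ _ (2 `^ (e * q%:R) * 2 `^ (lm + e * q%:R) * 2 `^ (l * (odds j m)%:R))).
  by rewrite !ler_wpM2r ?powR_ge0.
by rewrite -!pow2D ler_pow2; lra.
Qed.

(** The time up to which the drift is controlled is kappa q with kappa slightly
    below 2 / log_2(4/3).  Iterates of the Syracuse map that need more Terras
    steps are compared with T^J(m) at the last controlled time J. *)
Lemma Syr_bounds_of_drift {R : realType} (eps : R) : 0 < eps ->
  exists (kappa e : R) (q0 : nat), [/\ 0 < e, kappa * (2 - logb 2 3) < 2 &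
    forall m : nat, odd m -> (q0 <= trunc_log 2 m)%N -> ~~ drifting kappa e m ->
    forall k : nat,
        k%:R <= (logb 2 (4 / 3))^-1 * logb 2 (m%:R : R) ->
        (3 / 4) ^+ k * m%:R `^ (1 - eps) <= (iter k Syr m)%:R /\
        (iter k Syr m)%:R <= (3 / 4) ^+ k * m%:R `^ (1 + eps)].
Proof.
move=> eps0; set l := logb 2 3; pose h := 2 - l; pose H := h^-1.
have l1 := @logb23_gt1 R; have l2 := @logb23_lt2 R; rewrite -/l in l1 l2.
have h0 : 0 < h by rewrite /h; lra.
have h1 : h < 1 by rewrite /h; lra.
have hH : h * H = 1 by rewrite /H divff // gt_eqF.
have H1 : 1 < H by rewrite invf_gt1.
pose e := Num.min eps 1 / 10.
have [e0 e_eps e1] : [/\ 0 < e, 10 * e <= eps & 10 * e <= 1].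
  have a1 : Num.min eps 1 <= eps by rewrite ge_min lexx.
  have a2 : Num.min eps 1 <= 1 by rewrite ge_min lexx orbT.
  have a3 : 0 < Num.min eps 1 by rewrite lt_min eps0 ltr01.
  by rewrite /e; split; lra.
pose kappa := 2 * H - e.
have k0 : 0 <= kappa by rewrite /kappa; lra.
have kh : kappa * (2 - l) < 2.
  rewrite -/h /kappa mulrBl -mulrA (mulrC H) hH mulr1.
  by have := mulr_gt0 e0 h0; lra.
have [q0 poly] := linear_le_pow2 (kappa + 1) e e0.
exists kappa, e, (maxn q0 (Num.truncn ((2 * H + 1) / (5 * e))).+1); split => //.
move=> m om; rewrite geq_max => /andP[/poly {}poly qge] nb k.
have m0 : (0 < m)%N by case: m om {poly qge nb}.
have m0R : 0 < m%:R :> R by rewrite ltr0n.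
have nb' := driftingPn nb.
have /andP[qm mq] := @trunc_log_logb R _ m0; rewrite -[_.+1%:R]natr1 in mq.
set lm := logb 2 _ in qm mq *; set q := trunc_log 2 m in poly qge nb' qm mq *.
have {}qge : 2 * H + 1 <= 5 * (e * q%:R).
  rewrite [leRHS]mulrA [leRHS]mulrC -ler_pdivrMr; last by lra.
  by apply/ltW/(lt_le_trans (truncnS_gt _)); rewrite ler_nat.
have {}poly : 1 + kappa * q%:R <= 2 `^ (e * q%:R).
  apply: le_trans poly; have : 0 <= q%:R :> R by []; lra.
have h43 : logb 2 (4 / 3) = h :> R.
  rewrite /logb ln_div ?posrE // (_ : 4 = 2 ^+ 2); last by rewrite -natrX.
  rewrite lnXn // mulrBl /h /l /logb; congr (_ - _).
  by rewrite -[ln 2 *+ 2]mulr_natl mulfK // gt_eqF ?ln2_gt0.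
rewrite h43 -/H => kH.
have p34 : (3 / 4) ^+ k = 2 `^ (- (h * k%:R)) :> R.
  have e43 : (3 / 4) = 2 `^ (- h) :> R.
    by rewrite -h43 powRN pow2_logb //; field.
  by rewrite e43 -powR_mulrn ?powR_ge0 // -powRrM mulNr.
have pm (x : R) : m%:R `^ x = 2 `^ (lm * x) by rewrite powRrM pow2_logb.
rewrite p34 !pm -!pow2D.
have [ok [s [sT so]]] := iter_Syr_terras k om.
have hk : h * k%:R <= lm.
  by move: kH; rewrite -(ler_pM2l h0) mulrA hH mul1r.
have epslm : 10 * (e * q%:R) <= eps * lm.
  by rewrite mulrA ler_pM // mulr_ge0 // ltW.
(* Either Syr^k(m) = T^s(m) is reached within the controlled time, or not. *)
have [sk|ks] := leP s%:R (kappa * q%:R).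
  have /ler_normlP[lo hi] := nb' s sk.
  rewrite -sT; split.
    apply: le_trans (pow2_le_iter_terras s m0); rewrite ler_pow2 so -/lm -/l.
    by rewrite so in lo hi; rewrite /h; lra.
  apply: le_trans (iter_terras_le_pow2 m0 e0 k0 (ltW kh) nb sk poly) _.
  rewrite ler_pow2 so -/lm -/l -/q.
  by rewrite so in lo hi; rewrite /h; lra.
pose J := Num.truncn (kappa * q%:R).
have /andP[J1 J2] := truncn_itv (mulr_ge0 k0 (ler0n R q)); rewrite -/J -[_.+1%:R]natr1 in J1 J2.
have Js : (J <= s)%N by rewrite -(ler_nat R); apply: le_trans J1 (ltW ks).
have /ler_normlP[lo hi] := nb' J J1.
have ok' : (odds J m <= k)%N by rewrite -so odds_le.
have Hq : h * (H * q%:R) = q%:R by rewrite mulrA hH mul1r.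
have o_ge : H * q%:R - e * q%:R - 1 / 2 <= (odds J m)%:R by rewrite /kappa in J2; lra.
have eq0 : 0 <= e * q%:R by rewrite mulr_ge0 // ltW.
split.
  apply: (@le_trans _ _ 1); last by rewrite ler1n; case: (iter k Syr m) ok.
  rewrite -[leRHS](powRr0 2) ler_pow2.
  have ko : h * (H * q%:R - e * q%:R - 1 / 2) <= h * k%:R.
    by rewrite ler_pM2l // (le_trans o_ge) // ler_nat.
  have heq : h * (e * q%:R) <= e * q%:R by rewrite ler_piMl // ltW.
  lra.
apply: le_trans (_ : 2 `^ (k%:R - (odds J m)%:R) * (iter J terras m)%:R <= _).
  rewrite -sT -natrB // pow2n -natrM ler_nat -(subnKC Js) addnC iterD.
  apply: leq_trans (iter_terras_leq _ _) _.
  rewrite leq_mul2r leq_exp2l // -so -{2}(subnKC Js) oddsD.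
  by rewrite addKn leqnn orbT.
apply: le_trans (ler_wpM2l (powR_ge0 _ _) (iter_terras_le_pow2 m0 e0 k0 (ltW kh) nb J1 poly)) _.
rewrite -pow2D ler_pow2 -/lm -/l -/q.
have k_le : k%:R <= H * q%:R + H.
  have : H * lm <= H * (q%:R + 1) by rewrite ler_wpM2l; lra.
  lra.
have ko : (1 + h) * (k%:R - (odds J m)%:R) <= 2 * (H + 1 / 2 + e * q%:R).
  apply: ler_pM; rewrite ?subr_ge0 ?ler_nat //; lra.
rewrite /h in ko *; lra.
Qed.

Lemma count_odd_iota n : count odd (iota 0 (2 * n)) = n.
Proof.
elim: n => // n IH; rewrite mulnS addnC iotaD count_cat IH /= add0n.
by rewrite oddM /= addn1.
Qed.

Lemma count_uptoE (A : set nat) N :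
  count_upto A N = count (fun m => m \in A) (iota 0 N.+1).
Proof.
rewrite /count_upto -sum1_card -sum1_count.
by rewrite -[iota 0 N.+1]/(index_iota 0 N.+1) big_mkord.
Qed.

(** The exceptions up to 2n + 1 < 2^Q number at most Q C 2^((1-c)Q), while 2^Q is at
    most 4(n + 1). *)
Lemma density_one_of_sparse {R : realType} (A : set nat) (S : pred nat) :
  A `<=` Dplus -> sparse R S -> (forall m, odd m -> ~ A m -> S m) ->
  natural_density_one_in_Dplus R A.
Proof.
move=> AD [c [C [c0 c1 HS]]] co; split => //.
have C0 := sparse_bound_ge0 HS.
apply: (cvg_limn_inf_sup _).1; apply/cvgrPdist_le => /= d d0.
have [q0 H0] := linear_le_pow2 (4 * C / d) c c0.
exists (2 ^ q0)%N => // n /= nge.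
set N := (2 * n + 1)%N; pose Q := (trunc_log 2 N).+1.
have NS : N.+1 = (2 * n.+1)%N by rewrite /N; lia.
have NQ : (N < 2 ^ Q)%N by apply: trunc_log_ltn.
have QN : (2 ^ Q <= 4 * n.+1)%N.
  have : (2 ^ trunc_log 2 N <= N)%N by apply: trunc_logP; rewrite // /N addn1.
  by rewrite /Q expnS /N; lia.
have /H0 {H0} h : (q0 <= Q)%N.
  apply: leqW; rewrite -(@trunc_expnK 2 q0) //.
  by apply: leq_trunc_log; rewrite /N; lia.
have up : (count_upto A N <= n.+1)%N.
  rewrite count_uptoE NS -[leqRHS]count_odd_iota; apply: sub_count => m /=.
  by rewrite inE => /AD.
have low : (n.+1 <= count_upto A N + count S (index_iota 1 (2 ^ Q)))%N.
  rewrite count_uptoE -{1}(count_odd_iota n.+1) -NS.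
  apply: leq_trans (_ : count (fun m => m \in A) (iota 0 N.+1) +
    count (fun m => odd m && S m) (iota 0 N.+1) <= _)%N.
    rewrite -count_predUI; apply: leq_trans (leq_addr _ _).
    apply: sub_count => m /= om; rewrite om /=.
    by case: (boolP (m \in A)) => //=; rewrite notin_setE => /(co m om).
  rewrite leq_add2l -!size_filter; apply: uniq_leq_size.
    by rewrite filter_uniq // iota_uniq.
  move=> m; rewrite !mem_filter mem_index_iota mem_iota /= add0n.
  move=> /andP[/andP[om ->]] lm /=; rewrite (leq_trans lm NQ) andbT.
  by case: m om {lm}.
have n0 : 0 < n.+1%:R :> R by rewrite ltr0n.
have small : (count S (index_iota 1 (2 ^ Q)))%:R <= d * n.+1%:R.
  rewrite count_blocks; apply: le_trans (sum_blocks_leq Q c1 HS) _.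
  have QN' : 2 `^ Q%:R <= 4 * n.+1%:R :> R by rewrite pow2n -natrM ler_nat.
  apply: (@le_trans _ _ (d / 4 * 2 `^ Q%:R)); last first.
    rewrite [leRHS](_ : _ = d / 4 * (4 * n.+1%:R)); last by field.
    by rewrite ler_wpM2l // divr_ge0 // ltW.
  have -> : 2 `^ Q%:R = 2 `^ (c * Q%:R) * 2 `^ ((1 - c) * Q%:R).
    by rewrite -pow2D; congr (_ `^ _); ring.
  rewrite mulrA [leRHS]mulrA ler_wpM2r ?powR_ge0 //.
  apply: (@le_trans _ _ (d / 4 * (4 * C / d * (Q%:R + 1)))); last first.
    by rewrite ler_wpM2l // divr_ge0 // ltW.
  rewrite [leRHS](_ : _ = Q%:R * C + C); last by field; rewrite gt_eqF.
  by rewrite lerDl.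
have low' : n.+1%:R <= (count_upto A N)%:R + d * n.+1%:R.
  by apply: le_trans (lerD (lexx _) small); rewrite -natrD ler_nat.
rewrite ger0_norm ?subr_ge0 ?ler_pdivrMr ?mul1r ?ler_nat //.
rewrite lerBlDr -lerBlDl ler_pdivlMr //; lra.
Qed.

Theorem theorem1p10 (R : realType) (eps : R) (heps : 0 < eps) :
  natural_density_one_in_Dplus R
    [set m : nat | Dplus m /\
      forall k : nat,
        k%:R <= (logb 2 (4 / 3))^-1 * logb 2 (m%:R : R) ->
        (3 / 4) ^+ k * m%:R `^ (1 - eps) <= (iter k Syr m)%:R /\
        (iter k Syr m)%:R <= (3 / 4) ^+ k * m%:R `^ (1 + eps)].
Proof.
have [kappa [e [q0 [e0 kh H]]]] := Syr_bounds_of_drift eps heps.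
apply: (@density_one_of_sparse R _
  (fun m => (q0 <= trunc_log 2 m)%N ==> drifting kappa e m)).
- by move=> m [].
- apply: (@sparse_sub R _ _ q0 _ (drifting_sparse kappa e e0 kh)) => m _ le.
  by rewrite le.
- move=> m om nA; apply/implyP => le; apply: contraT => nb; case: nA.
  by split => //; exact: H.
Qed.
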